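(* Let $\lambda\in(0,1)$, let $\alpha,\beta$ be real numbers with $0<\alpha<\frac1\lambda$ and $\beta>0$, and let $X\sim\Gamma_\lambda(\alpha,\beta)$ be a degenerate gamma random variable with parameters $\alpha$ and $\beta$. For $n\in\mathbb{N}$, we have $$E[X^n]=\frac{1}{\beta^n}\cdot\frac{\binom{n+\alpha-1}{n}}{\binom{1-\lambda(\alpha+1)}{n}_\lambda}.$$
   Context: Fix $\lambda\in(0,1)$; $\mathbb{N}$ denotes the positive integers. For real $x$ put $(x)_{0,\lambda}=1$ and $(x)_{n,\lambda}=x(x-\lambda)(x-2\lambda)\cdots(x-(n-1)\lambda)$ for $n\ge1$; also $(x)_0=1$ and $(x)_n=x(x-1)\cdots(x-n+1)$ for $n\ge 1$. The binomial coefficient with real upper argument is $\binom{x}{n}=\frac{(x)_n}{n!}$, and the $\lambda$-binomial coefficient is $\binom{x}{n}_\lambda=\frac{(x)_{n,\lambda}}{n!}$ for $n\ge1$, with $\binom{x}{0}_\lambda=1$. The degenerate exponential function is $e_\lambda^{x}(t)=\sum_{n=0}^\infty (x)_{n,\lambda}\frac{t^n}{n!}$, i.e. $e_\lambda^x(t)=(1+\lambda t)^{x/\lambda}$, so that $e_\lambda^{-1}(t)=(1+\lambda t)^{-1/\lambda}$ for $t\ge0$. The degenerate gamma function is $\Gamma_\lambda(s)=\int_0^\infty e_\lambda^{-1}(t)\,t^{s-1}\,dt$ for $s\in\mathbb{C}$ with $0<\mathrm{Re}(s)<\frac1\lambda$. For $0<\alpha<\frac1\lambda$ and $\beta>0$,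 a continuous random variable $X$ is a degenerate gamma random variable with parameters $\alpha$ and $\beta$, written $X\sim\Gamma_\lambda(\alpha,\beta)$, if its probability density function is $$f_\lambda(x)=\frac{1}{\Gamma_\lambda(\alpha)}\,\beta\, e_\lambda^{-1}(\beta x)(\beta x)^{\alpha-1}\ \text{ for } x>0,\qquad f_\lambda(x)=0\ \text{ otherwise.}$$ The $n$-th moment of $X$ is $E[X^n]=\int_{-\infty}^\infty x^n f_\lambda(x)\,dx$.
   Formalization: The formal theorem adds the condition n + α < 1/λ; for n + α ≥ 1/λ the moment E[X^n] is infinite while the right-hand side is a finite real number or has a zero denominator (e.g. λ = α = 1/2, β = 1, n = 2 gives −12), so the formula fails there. *)

(* Defs.v *)
From HB Require Import structures.
From mathcomp Require Import all_boot all_order all_algebra.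
From mathcomp Require Import all_classical all_reals all_analysis.

Set Implicit Arguments.
Unset Strict Implicit.
Unset Printing Implicit Defensive.

Import Order.TTheory GRing.Theory Num.Theory.
Import numFieldNormedType.Exports.

Local Open Scope classical_set_scope.
Local Open Scope ring_scope.

(** $(x)_{n,\lambda} = x (x - \lambda) \cdots (x - (n-1)\lambda)$ *)
Definition deg_ffact (R : realType) (lambda x : R) (n : nat) : R :=
  \prod_(i < n) (x - i%:R * lambda).

(** $(x)_n = x (x - 1) \cdots (x - n + 1)$ for a real [x] *)
Definition real_ffact (R : realType) (x : R) (n : nat) : R :=
  \prod_(i < n) (x - i%:R).

Definition real_binom (R : realType) (x : R) (n : nat) : R :=
  real_ffact x n / n`!%:R.

Definition deg_binom (R : realType) (lambda x : R) (n : nat) : R :=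
  deg_ffact lambda x n / n`!%:R.

(** $e_\lambda^x(t)$, the sum of $\sum_n (x)_{n,\lambda} t^n / n!$ continued to
    all $t \ge 0$, where that series need not converge. *)
Definition deg_exp (R : realType) (lambda x t : R) : R :=
  (1 + lambda * t) `^ (x / lambda).

(** $\Gamma_\lambda(s)$ at a real argument. [Rintegral] is the finite part of
    the Lebesgue integral; this is the intended integral when
    $0 < s < 1/\lambda$. *)
Definition deg_gamma (R : realType) (lambda s : R) : R :=
  \int[@lebesgue_measure R]_(t in `]0, +oo[)
    (deg_exp lambda (-1) t * t `^ (s - 1)).

Definition deg_gamma_pdf (R : realType) (lambda alpha beta x : R) : R :=
  if 0 < x then
    (deg_gamma lambda alpha)^-1 * beta * deg_exp lambda (-1) (beta * x)
      * (beta * x) `^ (alpha - 1)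
  else 0.

Definition has_pdf (R : realType) (d : measure_display) (T : measurableType d)
    (P : probability T R) (X : {RV P >-> R}) (f : R -> R) : Prop :=
  forall A : set R, measurable A ->
    distribution P X A = (\int[@lebesgue_measure R]_(x in A) (f x)%:E)%E.

Definition deg_gamma_rv (R : realType) (d : measure_display)
    (T : measurableType d) (P : probability T R) (lambda alpha beta : R)
    (X : {RV P >-> R}) : Prop :=
  has_pdf X (deg_gamma_pdf lambda alpha beta).

(* Main.v *)
(** Put g_s(x) = e_lambda^{-1}(beta x) (beta x)^(s-1) and let J(s) be its integral
    over ]0, +oo[. The derivative of
    F(x) = (1 + lambda beta x)^(1 - 1/lambda) (beta x)^s is
    beta (s g_s - (1 - lambda (s+1)) g_{s+1}), and F vanishes at 0 and at +oo
    when 0 < s and lambda (s+1) < 1, so (1 - lambda (s+1)) J(s+1) = s J(s).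
    Up to the factor C = beta / Gamma_lambda(alpha), the density of X is g_alpha,
    so C J(alpha) = 1 and E[X^n] = C beta^(-n) J(alpha+n), which the recurrence
    evaluates. Keeping beta in the kernel avoids a change of variables. *)

Require Import Defs.
From HB Require Import structures.
From mathcomp Require Import all_boot all_order all_algebra.
From mathcomp Require Import all_classical all_reals all_analysis.
From mathcomp Require Import measurable_realfun ring.

Import Order.TTheory GRing.Theory Num.Theory.
Import numFieldNormedType.Exports.

Local Open Scope classical_set_scope.
Local Open Scope ring_scope.

(** * Integration against a measure given by a density *)

(** A [mu]-null set has zero integral, so [nu] is dominated by [mu] and has a Radon-Nikodym
    derivative. That derivative and [f] have the same integral over every measurable set, hence
    agree almost everywhere, and [f] can replace it in the change of measure. *)
Lemma ge0_integral_density (d : measure_display) (T : measurableType d)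
    (R : realType) (nu : {finite_measure set T -> \bar R})
    (mu : {sigma_finite_measure set T -> \bar R}) (f h : T -> \bar R) :
    (forall A, measurable A -> nu A = (\int[mu]_(x in A) f x)%E) ->
    measurable_fun setT f -> measurable_fun setT h -> (forall x, 0 <= h x)%E ->
  (\int[nu]_x h x = \int[mu]_x (h x * f x))%E.
Proof.
move=> nuf mf mh h0.
have numu : nu `<< mu.
  apply/null_content_dominatesP => A mA muA0.
  rewrite nuf//; apply: null_set_integral => //; exact: measurable_funTS.
rewrite -(Radon_Nikodym_SigmaFinite.change_of_variables numu h0)//.
have mRN : measurable_fun setT (Radon_Nikodym_SigmaFinite.f nu mu).
  exact: measurable_int (Radon_Nikodym_SigmaFinite.f_integrable numu).
apply: ae_eq_integral => //; [exact: emeasurable_funM..|].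
apply: ae_eqe_mul2l; apply: integral_ae_eq => //.
  exact: Radon_Nikodym_SigmaFinite.f_integrable.
by move=> A _ mA; rewrite -nuf// -Radon_Nikodym_SigmaFinite.f_integral.
Qed.

(** Sequential form of the one-sided limit [powR_cvg0]; the boundary values of the primitive are
    followed along sequences. *)
Lemma powR_cvg0_seq (R : realType) (u : R^nat) (p : R) : 0 < p ->
  (forall n, 0 < u n) -> u @ \oo --> 0 -> u n `^ p @[n --> \oo] --> 0.
Proof.
move=> p0 u0 cu; have /cvg_at_rightP := powR_cvg0 p0.
by move=> /(_ u); apply; split.
Qed.

Definition deg_gamma_kernel {R : realType} (lambda beta s x : R) : R :=
  deg_exp lambda (-1) (beta * x) * (beta * x) `^ (s - 1).

(** * The recurrence between kernel integrals *)

Section deg_gamma_recurrence.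
Variables (R : realType) (lambda beta : R).
Hypotheses (lambda_gt0 : 0 < lambda) (lambda_lt1 : lambda < 1).
Hypothesis beta_gt0 : 0 < beta.
Let mu := @lebesgue_measure R.
Let g := deg_gamma_kernel lambda beta.

Lemma deg_gamma_kernel_ge0 s x : 0 <= g s x.
Proof. by rewrite mulr_ge0// powR_ge0. Qed.

Lemma measurable_deg_gamma_kernel s : measurable_fun setT (g s).
Proof.
apply: measurable_funM.
  by apply: (measurableT_comp (measurable_powR _)); apply: measurable_funD => //;
    do 2 apply: measurable_funM => //.
by apply: (measurableT_comp (measurable_powR _)); exact: measurable_funM.
Qed.

Let is_derive_affine (a b x : R) : is_derive x 1 (fun y : R => a + b * y) b.
Proof.
apply: is_derive_eq.
by rewrite add0r mul1r /GRing.scale/= mulr1.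
Qed.

(** The affine base serves both factors of the primitive: [a = 1], [b = lambda * beta] for the first
    and [a = 0], [b = beta] for the second, whence the explicit [0 +] below. *)
Lemma is_derive_powR_affine (a b p x : R) : 0 < a + b * x ->
  is_derive x 1 (fun y => (a + b * y) `^ p) (b * (p * (a + b * x) `^ (p - 1))).
Proof.
move=> y0; have := is_derive_affine a b x => h1.
have h2 := is_derive1_powR p y0.
rewrite -mulrC.
exact: (is_derive1_comp (f := @powR R ^~ p) (g := fun y => a + b * y)).
Qed.

Definition deg_gamma_primitive (s x : R) : R :=
  (1 + lambda * (beta * x)) `^ (1 - 1 / lambda) * (beta * x) `^ s.

Lemma is_derive_deg_gamma_primitive (s x : R) : 0 < x ->
  is_derive x 1 (deg_gamma_primitive s)
    (beta * (s * g s x - (1 - lambda * (s + 1)) * g (s + 1) x)).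
Proof.
move=> x0; have bx0 : 0 < beta * x by rewrite mulr_gt0.
have y0 : 0 < 1 + lambda * beta * x by rewrite -mulrA addr_gt0// mulr_gt0.
have z0 : 0 < 0 + beta * x by rewrite add0r.
have -> : deg_gamma_primitive s = (fun x => (1 + lambda * beta * x) `^ (1 - 1 / lambda))
    * (fun x => (0 + beta * x) `^ s).
  by apply/funext => w; rewrite fctE /deg_gamma_primitive add0r mulrA.
have d1 := is_derive_powR_affine _ _ (1 - 1 / lambda) _ y0.
have d2 := is_derive_powR_affine _ _ s _ z0.
apply: is_derive_eq.
rewrite add0r -!mulrA /g /deg_gamma_kernel /deg_exp /=.
set y := 1 + _; set z := beta * x.
have y1 : 0 < y by rewrite /y mulrA.
have z1 : 0 < z by [].
have -> : s + 1 - 1 = s by ring.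
have -> : 1 - 1 / lambda - 1 = - 1 / lambda by field; exact: lt0r_neq0.
(* One factor is split off each power so that only [A] and [B] remain as atoms; with
   [y = 1 + lambda * z] the claim is then a field identity. *)
have -> : y `^ (1 - 1 / lambda) = y * y `^ (- 1 / lambda).
  rewrite -{2}(powRr1 (ltW y1)).
  rewrite -powRD; last by rewrite (gt_eqF y1) implybT.
  by congr (_ `^ _); rewrite mulNr.
have -> : z `^ s = z * z `^ (s - 1).
  rewrite -{2}(powRr1 (ltW z1)).
  by rewrite -powRD ?(gt_eqF z1) ?implybT//; congr (_ `^ _); ring.
rewrite /GRing.scale/=; set A := y `^ _; set B := z `^ (s - 1).
rewrite /y -/z; field; exact: lt0r_neq0.
Qed.

Lemma continuous_deg_gamma_kernel (s x : R) : 0 < x -> {for x, continuous (g s)}.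
Proof.
move=> x0; have bx0 : 0 < beta * x by rewrite mulr_gt0.
have y0 : 0 < 1 + lambda * beta * x by rewrite -mulrA addr_gt0// mulr_gt0.
have z0 : 0 < 0 + beta * x by rewrite add0r.
have -> : g s = (fun x => (1 + lambda * beta * x) `^ (- 1 / lambda))
    * (fun x => (0 + beta * x) `^ (s - 1)).
  by apply/funext => w; rewrite fctE /g /deg_gamma_kernel /deg_exp add0r mulrA.
apply: differentiable_continuous; apply/derivable1_diffP; apply: derivableM.
  by apply: ex_derive; exact: (is_derive_powR_affine _ _ (- 1 / lambda) _ y0).
by apply: ex_derive; exact: (is_derive_powR_affine _ _ (s - 1) _ z0).
Qed.

(** The fundamental theorem of calculus for the primitive, divided by [beta]. Terms are arranged so
    that each side is a sum: limits can then be taken in the extended reals with no risk of an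
    indeterminate difference, before the improper integrals are known to be finite. *)
Lemma integral_deg_gamma_kernel_itv (s a b : R) : 0 < a -> a < b ->
  let J s := (\int[mu]_(x in `[a, b]) (g s x)%:E)%E in
  (s%:E * J s + (deg_gamma_primitive s a / beta)%:E =
   (1 - lambda * (s + 1))%:E * J (s + 1)%R +
    (deg_gamma_primitive s b / beta)%:E)%E.
Proof.
move=> a0 ab J.
have within_cont (f : R -> R) : (forall x, 0 < x -> {for x, continuous f}) ->
    {within `[a, b], continuous f}.
  move=> cf; apply: continuous_in_subspaceT => x /[!inE]/=.
  by rewrite in_itv/= => /andP[ax _]; exact: cf (lt_le_trans a0 ax).
have Fcont x : 0 < x -> {for x, continuous (deg_gamma_primitive s)}.
  move=> x0; apply: differentiable_continuous; apply/derivable1_diffP.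
  by apply: ex_derive; exact: (is_derive_deg_gamma_primitive s _ x0).
have gint t : mu.-integrable `[a, b] (EFin \o g t).
  apply: continuous_compact_integrable; first exact: segment_compact.
  by apply: within_cont => x x0; exact: continuous_deg_gamma_kernel.
have FTC : (\int[mu]_(x in `[a, b])
    (beta * (s * g s x - (1 - lambda * (s + 1)) * g (s + 1) x))%:E =
    (deg_gamma_primitive s b)%:E - (deg_gamma_primitive s a)%:E)%E.
  apply: continuous_FTC2 => //.
  - apply: within_cont => x x0.
    apply: continuousM; first exact: cst_continuous.
    by apply: continuousB; apply: continuousM;
      [exact: cst_continuous|exact: continuous_deg_gamma_kernel
      |exact: cst_continuous|exact: continuous_deg_gamma_kernel].
  - have /continuous_within_itvP[//|_ Fa Fb] := within_cont _ Fcont.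
    split => // x; rewrite in_itv/= => /andP[ax _].
    by apply: ex_derive; exact: (is_derive_deg_gamma_primitive s _ (lt_trans a0 ax)).
  - move=> x; rewrite in_itv/= => /andP[ax _]; rewrite derive1E.
    have := is_derive_deg_gamma_primitive s _ (lt_trans a0 ax).
    by move=> dF; rewrite derive_val.
(* On a compact interval away from 0 the integrals are finite, so the identity reduces to real
   arithmetic. *)
have Jfin t : J t \is a fin_num by exact: (integrable_fin_num _ (gint t)).
have JZ k t : (\int[mu]_(x in `[a, b]) (k * g t x)%:E)%E = (k * fine (J t))%:E.
  under eq_integral do rewrite EFinM.
  by rewrite integralZl ?EFinM ?fineK//; exact: gint.
have intZ (k t : R) : mu.-integrable `[a, b] (fun x => (k * g t x)%:E).
  exact: (integrableZl _ k (gint t)).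
move: FTC; under eq_integral do rewrite EFinM EFinB.
rewrite integralZl//; last by apply: integrableB => //; exact: intZ.
rewrite integralB//; [|exact: intZ..].
rewrite !JZ.
rewrite -!EFinB -!EFinM => -[FTC].
rewrite -(fineK (Jfin s)) -(fineK (Jfin (s + 1))).
rewrite -!EFinM -!EFinD; congr EFin; apply/eqP; rewrite -subr_eq0; apply/eqP.
apply: (mulfI (lt0r_neq0 beta_gt0)); rewrite mulr0.
transitivity (beta * (s * fine (J s) - (1 - lambda * (s + 1)) * fine (J (s + 1)))
  - (deg_gamma_primitive s b - deg_gamma_primitive s a)).
  by field; exact: lt0r_neq0.
by rewrite FTC subrr.
Qed.

(** Starting at 2 keeps the left endpoint strictly below the right one for every [k], as the
    identity on [[a, b]] requires. *)
Let itv_seq (k : nat) : set R := `[k.+2%:R^-1, k.+2%:R].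

Let bigcup_itv_seq : \bigcup_k itv_seq k = `]0, +oo[%classic.
Proof.
apply/seteqP; split=> [x [k _]|x]; rewrite /itv_seq/= !in_itv/=.
  by case/andP => kx _; rewrite andbT (lt_le_trans _ kx)// invr_gt0.
(* A bound on [x + x^-1] exceeds both [x] and [x^-1], so a single index handles both endpoints. *)
rewrite andbT => x0; pose N := Num.bound (x + x^-1).
have xN : x + x^-1 < N.+2%:R.
  apply: (lt_trans (archi_boundP _)); first by rewrite addr_ge0// ?invr_ge0 ltW.
  by rewrite ltr_nat ltnW.
exists N => //=; rewrite in_itv/=; apply/andP; split.
  rewrite invf_ple ?posrE//; apply: le_trans (ltW xN).
  by rewrite lerDr ltW.
by apply: le_trans (ltW xN); rewrite lerDl invr_ge0 ltW.
Qed.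

Let cvg_integral_itv_seq (s : R) :
  (\int[mu]_(x in itv_seq k) (g s x)%:E @[k --> \oo] -->
   \int[mu]_(x in `]0%R, +oo[) (g s x)%:E)%E.
Proof.
rewrite -bigcup_itv_seq; apply: ge0_nondecreasing_set_cvg_integral.
- apply/nondecreasing_seqP => k; rewrite subsetEset /itv_seq => x /=.
  rewrite !in_itv/= => /andP[kx xk]; apply/andP; split.
    by apply: le_trans kx; rewrite lef_pV2 ?posrE// ler_nat.
  by rewrite (le_trans xk)// ler_nat.
- by move=> k; exact: measurable_itv.
- move=> k; apply/measurable_EFinP; apply: measurable_funTS.
  exact: measurable_deg_gamma_kernel.
- by move=> k x _; rewrite lee_fin deg_gamma_kernel_ge0.
Qed.

Let cvg_invnat : (k.+2%:R^-1 : R) @[k --> \oo] --> 0.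
Proof. by have := @cvg_harmonic R; rewrite -cvg_shiftS. Qed.

Let cvg_primitive_left (s : R) : 0 < s ->
  deg_gamma_primitive s k.+2%:R^-1 @[k --> \oo] --> 0.
Proof.
move=> s0; apply: (@squeeze_cvgr _ _ _ _ (cst 0)
  (fun k => (beta * k.+2%:R^-1) `^ s)).
(* The first factor is at most 1: its base is at least 1 and its exponent [1 - 1 / lambda] is
   negative. *)
- apply: nearW => k; rewrite mulr_ge0 ?powR_ge0//= ler_piMl ?powR_ge0//.
  set y := 1 + _; have y1 : 1 <= y by rewrite lerDl !mulr_ge0 ?ltW.
  rewrite -[X in _ <= X](powRr0 y) ler_powR// subr_le0 ler_pdivlMr// mul1r ltW//.
- exact: cvg_cst.
- apply: powR_cvg0_seq => //; first by move=> k; rewrite mulr_gt0.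
  by rewrite -[X in _ --> X](mulr0 beta); apply: cvgMr; exact: cvg_invnat.
Qed.

Let cvg_primitive_right (s : R) : 0 < s -> lambda * (s + 1) < 1 ->
  deg_gamma_primitive s k.+2%:R @[k --> \oo] --> 0.
Proof.
(* The exponent [p] is the decay rate at infinity, positive because [lambda * (s + 1) < 1]. With
   [z = beta * x], lowering the base [1 + lambda * z] to [lambda * z] under the negative exponent
   [- (p + s)] bounds the primitive by [lambda^-1 ^ s * (lambda * z) ^ (- p)]. *)
move=> s0 s1; pose p := 1 / lambda - 1 - s.
have p0 : 0 < p.
  by rewrite /p -addrA -opprD subr_gt0 ltr_pdivlMr// mulrC addrC.
apply: (@squeeze_cvgr _ _ _ _ (cst 0)
  (fun k => lambda^-1 `^ s * ((lambda * beta)^-1 * k.+2%:R^-1) `^ p)).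
- apply: nearW => k; rewrite mulr_ge0 ?powR_ge0//=.
  rewrite /deg_gamma_primitive; set z := beta * _.
  have z0 : 0 < z by rewrite mulr_gt0.
  have lz0 : 0 < lambda * z by rewrite mulr_gt0.
  have lz1 : lambda * z <= 1 + lambda * z by rewrite lerDr.
  have -> : (lambda * beta)^-1 * k.+2%:R^-1 = (lambda * z)^-1.
    by rewrite /z mulrA !invfM.
  have -> : 1 - 1 / lambda = - (p + s) by rewrite /p; ring.
  rewrite -(powR_inv1 (ltW lz0)) -powRrM mulN1r.
  have -> : z `^ s = lambda^-1 `^ s * (lambda * z) `^ s.
    by rewrite -powRM ?invr_ge0 ?ltW// mulKf// gt_eqF.
  rewrite mulrCA ler_wpM2l ?powR_ge0//.
  have -> : - p = - (p + s) + s by ring.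
  rewrite [X in _ <= X]powRD ?(gt_eqF lz0) ?implybT//.
  rewrite ler_wpM2r ?powR_ge0//.
  rewrite !powRN lef_pV2 ?posrE ?powR_gt0 ?(lt_le_trans lz0)//.
  have ps0 := ltW (addr_gt0 p0 s0); have lz2 := ltW lz0.
  by apply: ge0_ler_powR => //; rewrite nnegrE (le_trans lz2).
- exact: cvg_cst.
- rewrite -[X in _ --> X](mulr0 (lambda^-1 `^ s)); apply: cvgMr.
  apply: powR_cvg0_seq => //; first by move=> k; rewrite mulr_gt0// invr_gt0 mulr_gt0.
  by rewrite -[X in _ --> X](mulr0 (lambda * beta)^-1); apply: cvgMr; exact: cvg_invnat.
Qed.

Lemma integral_deg_gamma_kernelS (s : R) : 0 < s -> lambda * (s + 1) < 1 ->
  ((1 - lambda * (s + 1))%:E * \int[mu]_(x in `]0%R, +oo[) (g (s + 1) x)%:E =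
   s%:E * \int[mu]_(x in `]0%R, +oo[) (g s x)%:E)%E.
Proof.
move=> s0 s1.
have cvgJ (c : R) (t : R) (u : R^nat) : (0 <= c)%R -> u @ \oo --> 0%R ->
    (c%:E * (\int[mu]_(x in itv_seq k) (g t x)%:E) + (u k / beta)%:E
       @[k --> \oo] --> c%:E * \int[mu]_(x in `]0%R, +oo[) (g t x)%:E)%E.
  move=> c0 u0; rewrite -[X in _ --> X]adde0; apply: cvgeD.
  - by rewrite fin_num_adde_defl.
  - by apply: cvgeZl => //; exact: cvg_integral_itv_seq.
  - apply: cvg_EFin; first exact: nearW.
    by rewrite -[X in _ --> X](mul0r beta^-1); apply: cvgMl.
have c0 : 0 <= 1 - lambda * (s + 1) by rewrite subr_ge0 ltW.
have L := cvgJ _ (s + 1) _ c0 (cvg_primitive_right _ s0 s1).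
have L' := cvgJ _ s _ (ltW s0) (cvg_primitive_left _ s0).
(* By the identity on compact intervals, [L] and [L'] give limits of one and the same sequence. *)
apply: cvg_unique L _; first exact: ereal_hausdorff.
move: L'; under eq_cvg => k.
  rewrite integral_deg_gamma_kernel_itv ?invr_gt0//; last first.
    by rewrite (@lt_trans _ _ 1)// ?invf_lt1// ltr1n.
  over.
by [].
Qed.

End deg_gamma_recurrence.

(** * Iterated recurrence and its binomial form *)

(** Induction on [n]: the [i]-th factors are the two coefficients of the recurrence at [s + i].
    Keeping the products on opposite sides avoids division in the extended reals. *)
Lemma integral_deg_gamma_kernelD (R : realType) (lambda beta s : R) (n : nat) :
    0 < lambda -> lambda < 1 -> 0 < beta -> 0 < s -> lambda * (n%:R + s) < 1 ->
  ((\prod_(i < n) (1 - lambda * (s + 1) - i%:R * lambda))%:E *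
     \int[@lebesgue_measure R]_(x in `]0%R, +oo[)
       (deg_gamma_kernel lambda beta (s + n%:R) x)%:E =
   (\prod_(i < n) (s + i%:R))%:E *
     \int[@lebesgue_measure R]_(x in `]0%R, +oo[)
       (deg_gamma_kernel lambda beta s x)%:E)%E.
Proof.
move=> l0 l1 b0 s0; elim: n => [|n IH] ns; first by rewrite !big_ord0 addr0.
have ns' : lambda * (n%:R + s) < 1.
  by rewrite (le_lt_trans _ ns)// ler_pM2l// lerD2r ler_nat.
have sn0 : 0 < s + n%:R by rewrite ltr_wpDr.
have sn1 : lambda * (s + n%:R + 1) < 1 by rewrite -addrA natr1 addrC.
rewrite !big_ord_recr/= !EFinM -natr1 addrA.
have -> : 1 - lambda * (s + 1) - n%:R * lambda = 1 - lambda * (s + n%:R + 1).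
  by ring.
rewrite -muleA integral_deg_gamma_kernelS// muleCA IH// muleA.
by congr (_ * _)%E; exact: muleC.
Qed.

Lemma deg_gamma_pdfE (R : realType) (lambda alpha beta : R) :
  deg_gamma_pdf lambda alpha beta =
  (fun x => (deg_gamma lambda alpha)^-1 * beta * deg_gamma_kernel lambda beta alpha x)
    \_ `]0, +oo[.
Proof.
apply/funext => x; rewrite /deg_gamma_pdf patchE.
case: ifPn => x0; first by rewrite ifT -?mulrA// inE/= in_itv/= x0.
by rewrite ifF//; apply/negP; rewrite inE/= in_itv/= andbT (negbTE x0).
Qed.

Lemma deg_gamma_ge0 (R : realType) (lambda s : R) : 0 <= deg_gamma lambda s.
Proof. by apply: Rintegral_ge0 => x _; rewrite mulr_ge0// powR_ge0. Qed.

Lemma real_binom_div_deg_binom (R : realType) (lambda alpha : R) (n : nat) :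
  real_binom (n%:R + alpha - 1) n / deg_binom lambda (1 - lambda * (alpha + 1)) n =
  \prod_(i < n) (alpha + i%:R)
    / \prod_(i < n) (1 - lambda * (alpha + 1) - i%:R * lambda).
Proof.
have nf : n`!%:R != 0 :> R by rewrite pnatr_eq0 -lt0n fact_gt0.
rewrite /real_binom /deg_binom /real_ffact /deg_ffact invfM invrK.
have -> : \prod_(i < n) (n%:R + alpha - 1 - i%:R) = \prod_(i < n) (alpha + i%:R).
  (* Read backwards, the falling product from [n + alpha - 1] is the rising product from [alpha]. *)
  rewrite (reindex_inj rev_ord_inj)/=; apply: eq_bigr => i _.
  by rewrite natrB// -natr1; ring.
by rewrite -mulrA; congr (_ * _); rewrite mulrC mulfK.
Qed.

(** [has_pdf] speaks only of probabilities of sets; the passage to integrals goes through the law of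
    [X] and the density lemma. *)
Lemma ge0_expectation_has_pdf (R : realType) (d : measure_display)
    (T : measurableType d) (P : probability T R) (X : {RV P >-> R})
    (f : R -> R) (h : R -> \bar R) :
    has_pdf X f -> measurable_fun setT f -> measurable_fun setT h ->
    (forall x, 0 <= h x)%E ->
  (\int[P]_w h (X w) = \int[@lebesgue_measure R]_x (h x * (f x)%:E))%E.
Proof.
move=> Xf mf mh h0.
(* [R] and [measurableTypeR R], on which [lebesgue_measure] lives, have the same
   measurable sets but distinct displays. *)
have mX : measurable_fun setT (X : T -> measurableTypeR R).
  exact: (@measurable_funP _ _ _ _ _ X).
pose Y : {RV P >-> measurableTypeR R} :=
  @mfun_Sub _ _ T (measurableTypeR R) _ (mem_set mX).
transitivity (\int[distribution P Y]_x h x)%E.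
  by rewrite ge0_integral_distribution.
apply: (@ge0_integral_density _ _ R (distribution P Y) (@lebesgue_measure R)
  (EFin \o f) h) => //.
by apply/measurable_EFinP.
Qed.

(** * The moments *)

Theorem theorem1 (R : realType) (lambda alpha beta : R)
    (lambda01 : 0 < lambda < 1)
    (alpha_range : 0 < alpha < 1 / lambda)
    (beta_gt0 : 0 < beta)
    (d : measure_display) (T : measurableType d) (P : probability T R)
    (X : {RV P >-> R}) (HX : deg_gamma_rv lambda alpha beta X)
    (n : nat) (n_gt0 : (0 < n)%N)
    (moment_range : n%:R + alpha < 1 / lambda) :
  ('E_P[fun w : T => (X w ^+ n)%R])%E =
    (1 / beta ^+ n *
      (real_binom (n%:R + alpha - 1) n
        / deg_binom lambda (1 - lambda * (alpha + 1)) n))%:E.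
Proof.
have /andP[l0 l1] := lambda01; have /andP[a0 _] := alpha_range.
have nl : lambda * (n%:R + alpha) < 1 by rewrite mulrC -ltr_pdivlMr.
set C := (deg_gamma lambda alpha)^-1 * beta.
have C0 : 0 <= C by rewrite mulr_ge0 ?invr_ge0 ?deg_gamma_ge0// ltW.
pose g := deg_gamma_kernel lambda beta.
pose f := deg_gamma_pdf lambda alpha beta.
have fE : f = (fun x => C * g alpha x) \_ `]0, +oo[ by exact: deg_gamma_pdfE.
have mg s : measurable_fun setT (g s) by exact: measurable_deg_gamma_kernel.
have mf : measurable_fun setT f.
  rewrite fE; apply/(measurable_restrictT _ _).1 => //.
  by apply: measurable_funTS; exact: measurable_funM.
have intZ (k s : R) : 0 <= k ->
    (\int[@lebesgue_measure R]_(x in `]0%R, +oo[) (k * g s x)%:E =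
     k%:E * \int[@lebesgue_measure R]_(x in `]0%R, +oo[) (g s x)%:E)%E.
  move=> k0; under eq_integral do rewrite EFinM.
  rewrite ge0_integralZl//.
  - by apply/measurable_EFinP; apply: measurable_funTS; exact: mg.
  - by move=> x _; rewrite lee_fin deg_gamma_kernel_ge0.
(* The law of [X] has total mass 1, which normalizes the kernel integral without any change of
   variables. It also rules out the default [0^-1 = 0] inside [C]. *)
have norm1 : (C%:E * \int[@lebesgue_measure R]_(x in `]0%R, +oo[) (g alpha x)%:E = 1)%E.
  have := HX _ measurableT; rewrite probability_setT -/f fE => ->.
  rewrite -intZ// [LHS]integral_mkcond; apply: eq_integral => x _.
  by rewrite !patchE; case: ifP.
have X_gt0 : {ae P, forall w, 0 < X w}.
  exists (X @^-1` `]-oo, 0]); split.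
  - by rewrite -[Z in measurable Z]setTI; exact: (@measurable_funP _ _ _ _ _ X).
  - transitivity (distribution P X `]-oo, 0]) => //.
    rewrite HX//; apply: integral0_eq => x; rewrite /= in_itv/= => x0.
    by rewrite /deg_gamma_pdf ltNge x0.
  - by move=> w /= /negP; rewrite -leNgt in_itv.
(* [X > 0] almost surely, so [x ^+ n] may be replaced by a nonnegative function. *)
pose h (x : R) := (`|x| ^+ n)%:E.
have mh : measurable_fun setT h.
  by apply/measurable_EFinP; apply: measurable_funX; exact: normr_measurable.
transitivity (\int[P]_w (h \o X) w)%E.
  rewrite unlock; apply: ae_eq_integral => //.
  - by apply/measurable_EFinP; apply: measurable_funX; exact: (@measurable_funP _ _ _ _ _ X).
  - exact: (measurableT_comp mh (@measurable_funP _ _ _ _ _ X)).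
  - by apply: filterS X_gt0 => w Xw _; rewrite /= /h gtr0_norm.
rewrite (ge0_expectation_has_pdf _ _ _ _ _ _ _ HX mf mh); last first.
  by move=> x; rewrite lee_fin exprn_ge0.
(* For [x > 0], raising the parameter by [n] multiplies the kernel by [(beta * x) ^+ n], so [x ^+ n]
   is absorbed at the cost of [beta ^+ n]. *)
transitivity (\int[@lebesgue_measure R]_(x in `]0%R, +oo[)
    (C / beta ^+ n * g (alpha + n%:R) x)%:E)%E.
  rewrite [RHS]integral_mkcond; apply: eq_integral => x _.
  rewrite /= -/f fE !patchE; case: ifPn; last by rewrite mule0.
  rewrite inE/= in_itv/= andbT => x0; rewrite /h -EFinM gtr0_norm//; congr EFin.
  rewrite /g /deg_gamma_kernel addrAC.
  have bx0 : 0 < beta * x by rewrite mulr_gt0.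
  rewrite [in RHS]powRD ?(gt_eqF bx0) ?implybT// powR_mulrn ?ltW// exprMn.
  by field; rewrite expf_neq0// gt_eqF.
rewrite intZ; last by rewrite divr_ge0 ?exprn_ge0 // ltW.
(* Here [D] is the numerator and [N] the denominator. The factors of [N] are
   [1 - lambda * (i.+1 + alpha)], positive since [i.+1 <= n]. *)
rewrite real_binom_div_deg_binom; set D := \prod_(i < n) _; set N := \prod_(i < n) _.
have D0 : N != 0.
  rewrite prodf_seq_neq0; apply/allP => i _ /=.
  have ->: 1 - lambda * (alpha + 1) - i%:R * lambda = 1 - lambda * (i.+1%:R + alpha).
    by rewrite -natr1; ring.
  rewrite gt_eqF// subr_gt0 (le_lt_trans _ nl)// ler_pM2l// lerD2r ler_nat.
  exact: ltn_ord.
have := integral_deg_gamma_kernelD R lambda beta alpha n l0 l1 beta_gt0 a0 nl.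
rewrite -/N -/D -/(g _) => rec.
have NCJ : (N%:E * (C%:E * \int[@lebesgue_measure R]_(x in `]0%R, +oo[)
    (g (alpha + n%:R) x)%:E) = D%:E)%E.
  by rewrite muleCA rec muleCA norm1 mule1.
rewrite [C / _]mulrC EFinM -muleA mul1r [RHS]EFinM; congr (_ * _)%E.
by rewrite [D / N]mulrC [RHS]EFinM -NCJ muleA -EFinM mulVf// mul1e.
Qed.
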